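(* Let $G$ be a finite group and let $c\ge 0$ be an integer. Consider a profinite presentation $G=F/R$, where $F$ is the free profinite group on $d(G)+c$ generators and $R$ is a closed normal subgroup of $F$. Let $e$ be the minimal number of elements required to generate $R$ as a closed normal subgroup of $F$. Then $\hat r(G)=e-c$. In particular, the minimal number of relations occurs when the number of generators is minimal (i.e. equal to $d(G)$), and only in that case.
   Context: $d(G)$ denotes the minimum number of generators of the finite group $G$. A profinite presentation of a finite group $G$ consists of a free profinite group $F$ (on finitely many generators) and a finite subset $U$ of $F$ (the relations) such that $G\cong F/R$, where $R$ is the closed normal subgroup of $F$ generated by $U$. The number $\hat r(G)$ is the minimal number of relations among all profinite presentations of $G$. *)

(* Defs.v *)
From HB Require Import structures.
From mathcomp Require Import all_boot all_fingroup all_solvable.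
From mathcomp Require Import boolp classical_sets functions cardinality.
From mathcomp Require Import topology.

Set Implicit Arguments.
Unset Strict Implicit.
Unset Printing Implicit Defensive.

Local Open Scope classical_set_scope.
Local Open Scope card_scope.
Local Open Scope group_scope.

HB.mixin Record isTopologicalGroup G of monoid.Group G & Topological G := {
  mulg_continuous : continuous (fun xy : G * G => xy.1 * xy.2) ;
  invg_continuous : continuous (fun x : G => x^-1)
}.

#[short(type="topologicalGroupType")]
HB.structure Definition TopologicalGroup :=
  {G of isTopologicalGroup G & monoid.Group G & Topological G}.

HB.mixin Record isProfinite G of TopologicalGroup G := {
  profinite_compact : compact [set: G] ;
  profinite_hausdorff : hausdorff_space G ;
  profinite_totally_disconnected : totally_disconnected [set: G]
}.

#[short(type="profiniteGroupType")]
HB.structure Definition ProfiniteGroup :=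
  {G of isProfinite G & TopologicalGroup G}.

Definition free_profinite_on (n : nat) (F : profiniteGroupType)
    (x : 'I_n -> F) : Prop :=
  forall (H : profiniteGroupType) (h : 'I_n -> H),
    exists! f : F -> H,
      [/\ {morph f : a b / a * b}, continuous f & forall i, f (x i) = h i].

Definition closed_normal_subgroup (F : topologicalGroupType) (N : set F) :
    Prop :=
  [/\ closed N, N 1, forall a b, N a -> N b -> N (a * b),
      forall a, N a -> N a^-1 & forall a b, N a -> N (b^-1 * a * b)].

Definition closed_normal_closure (F : topologicalGroupType) (U : set F) :
    set F :=
  smallest (@closed_normal_subgroup F) U.

(* F / R is isomorphic to G, through the first isomorphism theorem.  When F is
   compact and R is closed, R has finite index, hence is open, so such a
   morphism is automatically continuous for the discrete topology of G. *)
Definition quotient_iso_to (F : topologicalGroupType) (R : set F)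
    (gT : finGroupType) (G : {group gT}) : Prop :=
  exists p : {multiplicative F -> gT},
    range p = [set g | g \in G] /\ [set a | p a = 1] = R.

Definition least (P : nat -> Prop) (m : nat) : Prop :=
  P m /\ forall k, P k -> (m <= k)%N.

Definition normally_generated_by (F : topologicalGroupType) (R : set F)
    (m : nat) : Prop :=
  exists U : set F, U #= `I_m /\ closed_normal_closure U = R.

Definition profinite_presentation (gT : finGroupType) (G : {group gT})
    (n m : nat) : Prop :=
  exists (F : profiniteGroupType) (x : 'I_n -> F) (U : set F),
    [/\ free_profinite_on x, U #= `I_m
      & quotient_iso_to (closed_normal_closure U) G].

Definition is_rhat (gT : finGroupType) (G : {group gT}) : nat -> Prop :=
  least (fun m => exists n, profinite_presentation G n m).

(* Main.v *)
Require Import Defs.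
From HB Require Import structures.
From mathcomp Require Import all_boot all_fingroup zmodp all_solvable.
From mathcomp Require Import boolp classical_sets functions cardinality.
From mathcomp Require Import topology.

(** Let F and F' be free profinite groups of ranks n and n' that map onto G
    with kernels R and R'.  The theorem follows from one comparison
    ([kernel_generated_transfer]): if R' is generated by m elements as a closed
    normal subgroup, then n' <= m + n and R is generated by m + n - n'
    elements.  Thus the deficiency, normal generators minus rank, is the same
    for every presentation of G, and as no presentation has rank below d(G) the
    fewest relators occur exactly at rank d(G).

    The comparison has two halves.  The first bounds the number of elements
    that generate R by data that can be compared between presentations.  For a
    finite quotient of F and a minimal normal subgroup N of it inside the image
    of R, k normal generators of the image of R modulo N lift to k normal
    generators unless each of the |N|^k lifts generates a complement of N, and
    distinct lifts generate distinct complements ([lift_normal_generators], in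
    the manner of Gaschuetz).  If N is not abelian there is only one
    complement; if N is abelian, distinct complements are kernels of distinct
    nontrivial F-equivariant homomorphisms from R to N.  So as soon as k > 0 and
    all finite N satisfy |Hom_F(R, N)| <= |N|^k, every finite image of R has k
    normal generators, and by compactness so has R
    ([kernel_normally_generated]).

    The second half estimates |Hom_F(R, N)|.  Restriction of derivations gives
    an exact sequence
      Der(F, N) -> Hom_F(R, N) -> H^2(G, N) -> 0,
    where |Der(F, N)| = |N|^n, and the kernel Der(G, N) of the first map also
    depends on G and N only.  Hence |Hom_F(R, N)| / |N|^n is independent of the
    presentation.  Instead of constructing H^2, [equivariant_homs_count] turns
    a pair of maps between F and F' over G into an explicit injection, and
    gets |Hom_F(R, N)| |N|^n' <= |N|^(m + n).

    It remains to exclude k = 0 for n > 0, by a large cyclic N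
    ([rank_le_relators]), to see that R has some finite set of normal
    generators ([kernel_finitely_generated]), and to produce a free profinite
    group of rank d(G) as a retract of the given one ([free_retract]). *)

Set Implicit Arguments.
Unset Strict Implicit.
Unset Printing Implicit Defensive.

Local Open Scope classical_set_scope.
Local Open Scope group_scope.

(** * Finite groups as profinite groups *)

(** Continuity for the discrete topology on A, with no topology put on A: finite
    groups are used below through their own structure. *)
Definition locally_constant (T : topologicalType) (A : Type) (f : T -> A) :=
  forall x, \forall y \near x, f y = f x.

(** The universal property of a free profinite group only speaks of profinite
    targets, so finite groups have to be presented as such. *)
Definition discrete_group (E : finGroupType) : Type := discrete_topology E.

HB.instance Definition _ (E : finGroupType) :=
  Topological.on (discrete_group E).
HB.instance Definition _ (E : finGroupType) :=
  Discrete_ofNbhs.Build (discrete_group E) erefl.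
HB.instance Definition _ (E : finGroupType) := isGroup.Build (discrete_group E)
  (@mulgA E) (@mul1g E) (@mulg1 E) (@mulVg E) (@mulgV E).

Lemma discrete_mulg_continuous (E : finGroupType) :
  continuous (fun ab : discrete_group E * discrete_group E => ab.1 * ab.2).
Proof.
move=> [a b] W /nbhs_singleton /= Wab; exists ([set a], [set b]) => //=.
  by split; exact: discrete_set1.
by move=> [a' b'] /= [-> ->].
Qed.

Lemma discrete_invg_continuous (E : finGroupType) :
  continuous (fun a : discrete_group E => a^-1).
Proof.
move=> a W /nbhs_singleton /= Wa.
by apply: (filterS _ (discrete_set1 a)) => b /= ->.
Qed.

HB.instance Definition _ (E : finGroupType) :=
  isTopologicalGroup.Build (discrete_group E)
    (@discrete_mulg_continuous E) (@discrete_invg_continuous E).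

Lemma discrete_group_compact (E : finGroupType) :
  compact [set: discrete_group E].
Proof. by apply: finite_compact; exact: (@finite_finset E). Qed.

Lemma discrete_group_hausdorff (E : finGroupType) :
  hausdorff_space (discrete_group E).
Proof.
by move=> a b /(_ _ _ (discrete_set1 a) (discrete_set1 b)) [_ [-> ->]].
Qed.

HB.instance Definition _ (E : finGroupType) :=
  isProfinite.Build (discrete_group E)
    (@discrete_group_compact E) (@discrete_group_hausdorff E)
    (zero_dimension_totally_disconnected
      (@discrete_zero_dimension (discrete_group E))).

Lemma locally_constantP (T : topologicalType) (E : finGroupType)
    (f : T -> discrete_group E) :
  locally_constant f <-> continuous f.
Proof.
split=> [lcf a W /nbhs_singleton Wfa|cf a].
  by apply: filterS (lcf a) => b /= ->.
exact: (cf a _ (discrete_set1 _)).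
Qed.

(** * Closed subgroups as profinite groups *)

Record closed_subgroup (F : topologicalGroupType) := ClosedSubgroup {
  csg_set :> F -> Prop;
  csg_closed : closed csg_set;
  csg1 : csg_set 1;
  csgM : forall a b, csg_set a -> csg_set b -> csg_set (a * b);
  csgV : forall a, csg_set a -> csg_set a^-1
}.

Section ClosedSubgroupType.
Variables (F : profiniteGroupType) (C : closed_subgroup F).

Definition csg_type : Type := {a : F | `[< C a >]}.

Let V : csg_type -> F := val.

HB.instance Definition _ := Choice.on csg_type.
HB.instance Definition _ := Topological.copy csg_type (initial_topology V).

Definition csg_elt (a : F) (Ca : C a) : csg_type := exist _ a (asboolT Ca).

Lemma csg_valP (a : csg_type) : C (val a). Proof. exact/asboolP/(valP a). Qed.

Let mul (a b : csg_type) := csg_elt (csgM (csg_valP a) (csg_valP b)).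
Let inv (a : csg_type) := csg_elt (csgV (csg_valP a)).
Let one := csg_elt (csg1 C).

Let mulA : associative mul.
Proof. by move=> a b c; apply: val_inj; exact: mulgA. Qed.
Let mul1 : left_id one mul.
Proof. by move=> a; apply: val_inj; exact: mul1g. Qed.
Let mulr1 : right_id one mul.
Proof. by move=> a; apply: val_inj; exact: mulg1. Qed.
Let mulV : left_inverse one inv mul.
Proof. by move=> a; apply: val_inj; exact: mulVg. Qed.
Let mulrV : right_inverse one inv mul.
Proof. by move=> a; apply: val_inj; exact: mulgV. Qed.

HB.instance Definition _ := isGroup.Build csg_type mulA mul1 mulr1 mulV mulrV.

Lemma csg_val_continuous : continuous V.
Proof. exact: initial_continuous. Qed.

Lemma csg_continuous_corestrict (T : topologicalType) (f : T -> csg_type) :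
  continuous (V \o f) -> continuous f.
Proof.
move=> cVf; apply/continuousP => _ [W oW <-].
by move/continuousP: cVf => /(_ _ oW).
Qed.

Let mul_continuous : continuous (fun ab : csg_type * csg_type => ab.1 * ab.2).
Proof.
apply: csg_continuous_corestrict => -[a b].
apply: (@continuous2_cvg _ F F F _ _ (fun ab : csg_type * csg_type => V ab.1)
  (fun ab => V ab.2) (fun a b => a * b)).
- exact: (mulg_continuous (V a, V b)).
- by apply: cvg_comp cvg_fst _; exact: csg_val_continuous.
- by apply: cvg_comp cvg_snd _; exact: csg_val_continuous.
Qed.

Let inv_continuous : continuous (fun a : csg_type => a^-1).
Proof.
apply: csg_continuous_corestrict => a.
apply: (@continuous_comp csg_type F F V (fun a => a^-1)).
  exact: csg_val_continuous.
exact: invg_continuous.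
Qed.

HB.instance Definition _ :=
  isTopologicalGroup.Build csg_type mul_continuous inv_continuous.

Let csg_compact : compact [set: csg_type].
Proof.
move=> Phi PPhi _.
have PV : ProperFilter (V @ Phi) by exact: fmap_proper_filter.
have PC : (V @ Phi) C.
  apply: (@filterS _ Phi _ setT) => [a _|]; first exact: csg_valP.
  exact: filterT.
have cptC := subclosed_compact (@csg_closed _ C) (@profinite_compact F)
  (@subsetT _ _).
have [a [Ca cla]] := cptC _ PV PC.
exists (csg_elt Ca); split=> // A B PA [_ [[W oW <-] /= Wa WB]].
have VA : (V @ Phi) (V @` A).
  by apply: (@filterS _ Phi _ A) => // b Ab; exists b.
have [_ [[b Ab <-] Wb]] := cla _ W VA (open_nbhs_nbhs (conj oW Wa)).
by exists b; split=> //; apply: WB.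
Qed.

Let csg_hausdorff : hausdorff_space csg_type.
Proof.
move=> a b cab; apply: val_inj; apply: (@profinite_hausdorff F) => A B nA nB.
have [c [Ac Bc]] := cab _ _ (csg_val_continuous nA) (csg_val_continuous nB).
by exists (val c).
Qed.

Let csg_totally_disconnected : totally_disconnected [set: csg_type].
Proof.
move=> a _; rewrite eqEsubset; split=> [b [D [Da _ cD] Db]|_ ->]; last first.
  exact: connected_component_refl.
apply: val_inj; change ([set val a] (val b)).
rewrite -(@profinite_totally_disconnected F (val a)) //.
exists (V @` D); last by exists b.
split=> //; first by exists a.
apply: connected_continuous_connected => //.
by apply: continuous_subspaceT; exact: csg_val_continuous.
Qed.

HB.instance Definition _ := isProfinite.Build csg_type
  csg_compact csg_hausdorff csg_totally_disconnected.

End ClosedSubgroupType.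

(** * Finite quotients separate the points of a profinite group *)

Section ZeroDimensional.
Variable T : topologicalType.
Hypotheses (cptT : compact [set: T]) (hsT : hausdorff_space T).

Definition quasi_component (x : T) : set T :=
  [set y | forall D, clopen D -> D x -> D y].

Lemma quasi_component_closed x : closed (quasi_component x).
Proof.
have -> : quasi_component x = \bigcap_(D in [set D | clopen D /\ D x]) D.
  rewrite predeqE => y; split=> [qy D [cD Dx]|qy D cD Dx]; first exact: qy.
  by apply: (qy D).
by apply: closed_bigI => D [[]].
Qed.

(** Were every clopen D around x to leave U, the sets D minus U would form a
    filter base on a compact set, and a cluster point of it would lie outside U
    but in every D. *)
Lemma clopen_sub_open x (U : set T) :
  open U -> quasi_component x `<=` U ->
  exists D, [/\ clopen D, D x & D `<=` U].
Proof.
move=> oU QU; apply: contrapT => nD.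
pose Phi := filter_from [set D | clopen D /\ D x] (fun D => D `&` ~` U).
have PPhi : ProperFilter Phi.
  apply: filter_from_proper.
    apply: filter_from_filter; first by exists setT; split=> //; exact: clopenT.
    move=> D1 D2 [cD1 D1x] [cD2 D2x]; exists (D1 `&` D2).
      by split=> //; exact: clopenI.
    by move=> y [[? ?] ?].
  move=> D [cD Dx]; apply/set0P/eqP => DU0; apply: nD; exists D; split=> //.
  by rewrite -[U]setCK; apply/disjoints_subset.
have PU : Phi (~` U) by exists setT; [split=> //; exact: clopenT | move=> y []].
have cptU := subclosed_compact (open_closedC oU) cptT (@subsetT _ _).
have [y [nUy cly]] := cptU Phi PPhi PU.
apply: nUy; apply: QU => D cD Dx; apply: contrapT => nDy.
have PD : Phi D by exists D => // z [].
have oDc : open (~` D) by apply: closed_openC; case: cD.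
by have [z []] := cly D _ PD (open_nbhs_nbhs (conj oDc nDy)).
Qed.

(** Separate A and B by open sets; by the previous lemma a clopen D around x
    stays in their union, so the part of D near A is itself clopen and contains
    the whole quasi-component. *)
Lemma quasi_component_split x (A B : set T) :
  closed A -> closed B -> A `&` B = set0 -> quasi_component x = A `|` B ->
  A x -> B = set0.
Proof.
move=> cA cB AB QAB Ax.
have nB : set_nbhs A (~` B).
  apply/set_nbhsP; exists (~` B); split=> //; first exact: closed_openC.
  by apply/disjoints_subset.
have [P nP PB] := compact_normal hsT cptT cA nB.
have [U [oU AU UP]] := (set_nbhsP _ _).1 nP.
have [||D [[oD cD] Dx DUB]] := @clopen_sub_open x (U `|` ~` closure P).
- by apply: openU => //; exact/closed_openC/closed_closure.
- rewrite QAB => y [/AU|By]; first by left.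
  by right => /PB.
have DUE : D `&` U = D `\` ~` closure P.
  rewrite predeqE => y; split=> [[Dy Uy]|[Dy nPy]]; split=> //.
    by move=> nPy; apply/nPy/subset_closure/UP.
  by have [//|] := DUB _ Dy.
rewrite -subset0 => y By.
have [_ Uy] : (D `&` U) y.
  have qy : quasi_component x y by rewrite QAB; right.
  apply: qy; last by split=> //; exact: AU.
  split; first exact: openI.
  rewrite DUE setDE setCK; apply: closedI => //; exact: closed_closure.
by apply: (PB y) By; exact/subset_closure/UP.
Qed.

(** A subset that is relatively open and closed in the quasi-component and its
    relative complement are disjoint closed sets, so the one without x is
    empty. *)
Lemma quasi_component_connected x : connected (quasi_component x).
Proof.
move=> B [b Bb] [C oC BC] [D cD BD].
have Qc := @quasi_component_closed x.
pose B' := quasi_component x `&` ~` C.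
have cB : closed B by rewrite BD; exact: closedI.
have cB' : closed B' by apply: closedI => //; exact: open_closedC.
have BB' : B `&` B' = set0.
  by rewrite BC -subset0 => y [[_ ?] []].
have QBB' : quasi_component x = B `|` B'.
  rewrite BC predeqE => y; split=> [qy|[[]//|[]//]].
  by have [Cy|nCy] := pselect (C y); [left|right].
have [Bx|B'x] : (B `|` B') x by rewrite -QBB'.
  by rewrite QBB' (quasi_component_split cB cB' BB' QBB' Bx) setU0.
have B0 : B = set0.
  by apply: (quasi_component_split cB' cB _ _ B'x); rewrite 1?setIC 1?setUC.
by rewrite B0 in Bb.
Qed.

Lemma totally_disconnected_zero_dimensional :
  totally_disconnected [set: T] -> zero_dimensional T.
Proof.
move=> tdT x y xy; apply: contrapT => nU.
suff /eqP : y = x by rewrite eq_sym (negPf xy).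
have /(_ I) := tdT x; rewrite eqEsubset => -[+ _]; apply.
exists (quasi_component x); last first.
  by move=> D cD Dx; apply: contrapT => nDy; apply: nU; exists D.
by split=> //; exact: quasi_component_connected.
Qed.

End ZeroDimensional.

(** The fibres form an open cover.  The finite set of values is returned as an
    ordinal, with representatives, so that it can be permuted. *)
Lemma locally_constant_finite_range (T : topologicalType) (A : Type)
    (f : T -> A) :
  compact [set: T] -> locally_constant f ->
  exists k (iota : T -> 'I_k) (rep : 'I_k -> T),
    cancel rep iota /\ forall a b, iota a = iota b <-> f a = f b.
Proof.
move=> /compact_near_coveringP cptT lcf.
pose Phi := filter_from setT
  (fun s : seq T => [set s' : seq T | {subset s <= s'}]).
have FPhi : Filter Phi.
  apply: filter_from_filter; first by exists [::].
  move=> s1 s2 _ _; exists (s1 ++ s2) => // s' s12; split=> a sa;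
    by apply: s12; rewrite mem_cat sa ?orbT.
have [|s _ sT] := cptT _ Phi (fun s a => exists2 b, b \in s & f a = f b) FPhi.
  move=> a _; exists ([set b | f b = f a], [set s | a \in s]).
    by split; [exact: lcf | exists [:: a] => // s'; apply; exact: mem_head].
  by move=> [b s] [/= fba sa]; exists a.
have fs a : has (fun b => `[< f a = f b >]) s.
  have [b bs fab] := sT s (fun=> id) a I.
  by apply/hasP; exists b => //; exact/asboolP.
pose r a := nth a s (find (fun b => `[< f a = f b >]) s).
have fr a : f (r a) = f a.
  exact/esym/asboolP/(nth_find a (fs a)).
have rs a : r a \in (s : seq T) by rewrite mem_nth // -has_find.
have rE a b : r a = r b <-> f a = f b.
  split=> [rab|fab]; first by rewrite -fr rab fr.
  by rewrite /r fab; apply: set_nth_default; rewrite -has_find; exact: fs.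
pose t := undup [seq r a | a <- s].
have rt a : r a \in t.
  rewrite mem_undup; apply/mapP; exists (r a) => //.
  by apply/rE; rewrite fr.
pose iota a : 'I_(size t) :=
  Ordinal (eq_ind_r is_true (rt a) (index_mem (r a) t)).
pose rep (i : 'I_(size t)) := tnth (in_tuple t) i.
have rrep i : r (rep i) = rep i.
  have : rep i \in t by exact: mem_tnth.
  by rewrite mem_undup => /mapP[a _ ->]; apply/rE; exact: fr.
exists (size t), iota, rep; split=> [i|a b].
  apply: val_inj; rewrite /= rrep /rep (tnth_nth (rep i)) index_uniq //.
  exact: undup_uniq.
rewrite -rE; split=> [/(congr1 val)/= /index_inj|]; first by apply.
by move=> rab; apply: val_inj; rewrite /= rab.
Qed.

Record finhom (F : topologicalGroupType) (E : finGroupType) := FinHom {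
  finhom_fun :> F -> E;
  finhomM : {morph finhom_fun : a b / a * b};
  finhom_lc : locally_constant finhom_fun
}.

Section MorphFacts.
Variables (F H : groupType) (f : F -> H).
Hypothesis fM : {morph f : a b / a * b}.

Lemma morphg1 : f 1 = 1.
Proof. by apply: (mulgI (f 1)); rewrite -fM !mulg1. Qed.

Lemma morphgV a : f a^-1 = (f a)^-1.
Proof. by apply: (mulgI (f a)); rewrite -fM !mulgV morphg1. Qed.

Lemma morphgJ a b : f (a ^ b) = f a ^ f b.
Proof. by rewrite !conjgE !fM morphgV. Qed.

End MorphFacts.

Section FinhomFacts.
Variables (F : topologicalGroupType) (E : finGroupType) (pi : finhom F E).

Lemma finhom1 : pi 1 = 1. Proof. exact: morphg1 (@finhomM _ _ pi). Qed.

Lemma finhomV a : pi a^-1 = (pi a)^-1.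
Proof. exact: morphgV (@finhomM _ _ pi) a. Qed.

Lemma finhomJ a b : pi (a ^ b) = pi a ^ pi b.
Proof. exact: morphgJ (@finhomM _ _ pi) a b. Qed.

Lemma finhomX a j : pi (a ^+ j) = pi a ^+ j.
Proof.
elim: j => [|j IHj]; first exact: finhom1.
by rewrite !expgS finhomM IHj.
Qed.

End FinhomFacts.

Lemma locally_constant_comp (T S : topologicalType) (A : Type)
    (f : S -> A) (g : T -> S) :
  locally_constant f -> continuous g -> locally_constant (f \o g).
Proof. by move=> lcf cg a; exact: (cg a _ (lcf (g a))). Qed.

Lemma locally_constant_eq_closed (T : topologicalType) (A : Type)
    (f g : T -> A) :
  locally_constant f -> locally_constant g -> closed [set a | f a = g a].
Proof.
move=> lcf lcg; rewrite -[X in closed X]setCK; apply: open_closedC.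
rewrite openE => a /= nfg; apply: filterS2 (lcf a) (lcg a) => b.
by move=> /= -> ->.
Qed.

Section Translations.
Variable F : topologicalGroupType.

Lemma mulg_nearl (P : set F) (a b : F) :
  nbhs (a * b) P -> \forall c \near a, P (c * b).
Proof.
move=> nP; apply: (@continuous2_cvg _ F F F (nbhs a) _ id (fun=> b)
  (fun x y : F => x * y) a b _ _ _ P nP) => //.
  exact: (mulg_continuous (a, b)).
exact: cvg_cst.
Qed.

Lemma mulg_nearr (P : set F) (a b : F) :
  nbhs (b * a) P -> \forall c \near a, P (b * c).
Proof.
move=> nP; apply: (@continuous2_cvg _ F F F (nbhs a) _ (fun=> b) id
  (fun x y : F => x * y) b a _ _ _ P nP) => //.
  exact: (mulg_continuous (b, a)).
exact: cvg_cst.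
Qed.

End Translations.

Section Separation.
Variable F : profiniteGroupType.

(** A clopen D is stable under multiplication by the elements of a neighbourhood
    of 1, by compactness; so a and any nearby c give the same translate of D. *)
Lemma clopen_translates_locally_constant (D : set F) : clopen D ->
  locally_constant (fun a => [set b | D (a^-1 * b)]).
Proof.
move=> [oD cD].
have lcD : locally_constant (fun a => `[< D a >]).
  move=> a; have [Da|nDa] := pselect (D a).
    apply: filterS (open_nbhs_nbhs (conj oD Da)) => b Db.
    by rewrite (asboolT Da) asboolT.
  apply: filterS (open_nbhs_nbhs (conj (closed_openC cD) nDa)) => b nDb.
  by rewrite (asboolF nDa) asboolF.
have stab : \forall a \near (1 : F), [set: F] `<=` (fun b => D (a * b) = D b).
  have /compact_near_coveringP cF := @profinite_compact F.
  apply: (cF F (nbhs (1 : F)) (fun a b => D (a * b) = D b)) => b _.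
  have lcM : nbhs (1 * b) [set c | `[< D c >] = `[< D b >]].
    by rewrite mul1g; exact: lcD.
  have [[A B] [/= nA nB] AB] := @mulg_continuous F (1, b) _ lcM.
  exists (B `&` [set c | `[< D c >] = `[< D b >]], A) => //=.
    by split=> //; apply: filterI => //; exact: lcD.
  move=> [c a] /= [[Bc Dc] Aa].
  have /= Dac := AB (a, c) (conj Aa Bc).
  by rewrite propeqE; split=> /asboolT; [rewrite Dac -Dc | rewrite Dc -Dac];
    move/asboolP.
move=> a; apply: filterS; last first.
  apply: (mulg_nearr (b := a^-1)).
  by rewrite mulVg; exact: stab.
move=> c /= Dca; rewrite predeqE => b /=.
by rewrite -(Dca (c^-1 * b) I) /= -mulgA mulVKg.
Qed.

(** Inside W there is a clopen D containing 1, and D has finitely many left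
    translates.  The group permutes them, and an element that fixes D itself
    lies in D since 1 does. *)
Theorem finhom_separates (W : set F) : nbhs 1 W ->
  exists (E : finGroupType) (pi : finhom F E), forall a, pi a = 1 -> W a.
Proof.
move=> nW.
have zdF := totally_disconnected_zero_dimensional (@profinite_compact F)
  (@profinite_hausdorff F) (@profinite_totally_disconnected F).
have [D [D1 cD] DW] := zero_dimensional_cvg
  (@profinite_hausdorff F) zdF (@profinite_compact F) nW.
have lct := clopen_translates_locally_constant cD.
have [k [iota [rep [repK iotaE]]]] :=
  locally_constant_finite_range (@profinite_compact F) lct.
have trM a b c : iota a = iota b -> iota (c * a) = iota (c * b).
  move=> /iotaE ab; apply/iotaE; rewrite predeqE => d /=.
  have := congr1 (@^~ (c^-1 * d)) ab => /= ab'.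
  by rewrite !invgM -!mulgA ab'.
(* Permutations compose from left to right, whence the inverse. *)
pose act a (i : 'I_k) := iota (a^-1 * rep i).
have repE a : iota (rep (iota a)) = iota a by rewrite repK.
have actM a b i : act b (act a i) = act (a * b) i.
  by rewrite /act invgM -mulgA; apply: trM.
have act1 i : act 1 i = i by rewrite /act invg1 mul1g repK.
have act_inj a : injective (act a).
  by apply: (can_inj (g := act a^-1)) => i; rewrite actM mulgV act1.
pose pi a := perm (act_inj a).
have piM : {morph pi : a b / a * b}.
  by move=> a b; apply/permP => i; rewrite permM !permE actM.
have lcpi : locally_constant pi.
  suff lc1 : \forall a \near (1 : F), pi a = 1.
    move=> a; have lca : nbhs (a * a^-1) [set b | pi b = 1] by rewrite mulgV.
    apply: filterS (mulg_nearl lca) => b /=.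
    rewrite piM (morphgV piM) => e.
    by rewrite -[pi b](mulgVK (pi a)) e mul1g.
  have : \forall a \near (1 : F), forall i, act a i = i.
    apply: filter_forall => i.
    have lci : nbhs (1 * rep i) [set c | iota c = i].
      rewrite mul1g; apply: filterS (lct (rep i)) => c /iotaE /= ->.
      exact: repK.
    apply: filterS (mulg_nearl lci) => a /= ai.
    have act_i : act a^-1 i = i by rewrite /act invgK.
    by rewrite -[in LHS]act_i actM mulVg act1.
  by apply: filterS => a ai; apply/permP => i; rewrite permE perm1 ai.
exists {perm 'I_k}, (FinHom piM lcpi) => a /= pia1.
apply: DW; have : iota (a^-1 * 1) = iota 1.
  have := congr1 (fun s : {perm 'I_k} => s (iota 1)) pia1.
  by rewrite permE perm1 /act => <-; apply: trM; rewrite repE.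
rewrite mulg1 => /iotaE /(congr1 (@^~ 1)) /=.
by rewrite invgK mulg1 invg1 mulg1 => ->.
Qed.

End Separation.

(** * Free profinite groups *)

Section FreeProfinite.
Variables (n : nat) (F : profiniteGroupType) (x : 'I_n -> F).
Hypothesis freeF : free_profinite_on x.

Lemma free_endo_id (f : F -> F) :
  {morph f : a b / a * b} -> continuous f -> (forall i, f (x i) = x i) ->
  forall a, f a = a.
Proof.
move=> fM fC fx a; have [g [_ gU]] := freeF x.
rewrite -(gU f) // (gU id) //; split=> // b; exact: cvg_id.
Qed.

(** The generators define a map from F to the profinite group C whose composite
    with the inclusion fixes them, hence is the identity of F. *)
Theorem free_generated (C : closed_subgroup F) :
  (forall i, C (x i)) -> forall a, C a.
Proof.
move=> Cx a; have [f [[fM fC fx] _]] := freeF (fun i => csg_elt (Cx i)).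
have -> : a = val (f a); last exact: csg_valP.
apply/esym/(@free_endo_id (fun b => val (f b))) => [b c|b|i]; last first.
- by rewrite fx.
- apply: (@continuous_comp F (csg_type C) F f val); first exact: fC.
  exact: csg_val_continuous.
- by rewrite fM.
Qed.

Theorem free_finhom (E : finGroupType) (h : 'I_n -> E) :
  exists theta : finhom F E, forall i, theta (x i) = h i.
Proof.
have [f [[fM fC fx] _]] := freeF (h : 'I_n -> discrete_group E).
by exists (FinHom (E := E) fM ((locally_constantP f).2 fC)).
Qed.

End FreeProfinite.

(** The endomorphism rho that kills the last c generators is idempotent; the
    closed subgroup of its fixed points is free on the first d generators. *)
Theorem free_retract (d c : nat) (F : profiniteGroupType)
    (x : 'I_(d + c) -> F) :
  free_profinite_on x ->
  exists (F' : profiniteGroupType) (x' : 'I_d -> F'), free_profinite_on x'.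
Proof.
move=> freeF.
pose ext (H : groupType) (h : 'I_d -> H) (i : 'I_(d + c)) :=
  match fintype.split i with inl j => h j | inr _ => 1 end.
have extl (H : groupType) (h : 'I_d -> H) j : ext H h (lshift c j) = h j.
  by rewrite /ext (unsplitK (inl j)).
have extr (H : groupType) (h : 'I_d -> H) j : ext H h (rshift d j) = 1.
  by rewrite /ext (unsplitK (inr j)).
have [rho [[rhoM rhoC rhox] _]] := freeF F (ext F (x \o lshift c)).
have rhol j : rho (x (lshift c j)) = x (lshift c j) by rewrite rhox extl.
have rhor j : rho (x (rshift d j)) = 1 by rewrite rhox extr.
have rhoK a : rho (rho a) = rho a.
  have [f [_ fU]] := freeF F (ext F (x \o lshift c)).
  rewrite -[in RHS](fU rho) // (fU (rho \o rho)) //; split=> [b e|b|i] /=.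
  - by rewrite !rhoM.
  - by apply: continuous_comp; exact: rhoC.
  - by rewrite -(fintype.splitK i) /ext unsplitK;
      case: (fintype.split i) => j /=;
      rewrite ?rhol ?rhor ?rhol ?(morphg1 rhoM).
have fixC : closed [set a | rho a = a].
  have -> : [set a | rho a = a] = (fun a => rho a * a^-1) @^-1` [set 1].
    rewrite predeqE => a /=; split=> [->|e]; first exact: mulgV.
    by rewrite -[LHS](mulgVK a) e mul1g.
  apply: closed_comp; last first.
    exact/accessible_closed_set1/hausdorff_accessible/profinite_hausdorff.
  move=> a _; apply: (@continuous2_cvg _ F F F _ _ rho (fun b => b^-1)
    (fun u v => u * v)) => //.
  - exact: (mulg_continuous (rho a, a^-1)).
  - exact: rhoC.
  - exact: invg_continuous.
have fix1 : rho 1 = 1 by exact: (morphg1 rhoM).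
have fixM a b : rho a = a -> rho b = b -> rho (a * b) = a * b.
  by rewrite rhoM => -> ->.
have fixV a : rho a = a -> rho a^-1 = a^-1 by rewrite (morphgV rhoM) => ->.
pose C := ClosedSubgroup fixC fix1 fixM fixV.
pose r (a : F) : csg_type C := csg_elt (rhoK a : C (rho a)).
have rM : {morph r : a b / a * b} by move=> a b; apply: val_inj; exact: rhoM.
have rC : continuous r by apply: csg_continuous_corestrict; exact: rhoC.
have rK (a : csg_type C) : r (val a) = a by apply: val_inj; exact: (csg_valP a).
exists (csg_type C), (fun j => r (x (lshift c j))) => H h.
have [f [[fM fC fx] fU]] := freeF H (ext H h).
exists (f \o val); split; first split => /=.
- by move=> a b; exact: fM.
- move=> a; apply: (@continuous_comp (csg_type C) F H val f).
    exact: csg_val_continuous.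
  exact: fC.
- by move=> j; rewrite rhol fx extl.
move=> g [gM gC gx].
have gr : f = g \o r.
  apply: fU; split=> [a b||i] /=.
  - by rewrite rM gM.
  - move=> b; apply: (@continuous_comp F (csg_type C) H r g); first exact: rC.
    exact: gC.
  - rewrite -(fintype.splitK i) /ext unsplitK.
    case: (fintype.split i) => j /=; first exact: gx.
    have -> : r (x (rshift d j)) = 1 by apply: val_inj; exact: rhor.
    exact: (morphg1 gM).
by apply: funext => a /=; rewrite gr /= rK.
Qed.

(** * Counting equivariant homomorphisms *)

Definition himage (F : topologicalGroupType) (E : finGroupType)
    (pi : finhom F E) (S : set F) : {set E} :=
  [set e | `[< exists2 a, S a & pi a = e >]]%SET.

Lemma himageP (F : topologicalGroupType) (E : finGroupType) (pi : finhom F E)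
    (S : set F) e :
  reflect (exists2 a, S a & pi a = e) (e \in himage pi S).
Proof. by rewrite inE; exact: asboolP. Qed.

Lemma mem_himage (F : topologicalGroupType) (E : finGroupType) (pi : finhom F E)
    (S : set F) a : S a -> pi a \in himage pi S.
Proof. by move=> Sa; apply/himageP; exists a. Qed.

Lemma himage_group_set (F : topologicalGroupType) (E : finGroupType)
    (pi : finhom F E) (S : set F) :
  S 1 -> (forall a b, S a -> S b -> S (a * b)) -> group_set (himage pi S).
Proof.
move=> S1 SM; apply/group_setP; split.
  by apply/himageP; exists 1 => //; exact: finhom1.
move=> _ _ /himageP[a Sa <-] /himageP[b Sb <-].
by rewrite -finhomM; apply: mem_himage; exact: SM.
Qed.

(** The homomorphisms B -> N that commute with conjugation by L, extended by 1
    outside B so that they form a finite set.  For B and L the images of R and F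
    under a map to E and N centralized by B, this is the part of Hom_F(R, N)
    that factors through E. *)
Definition equivariant_homs (E : finGroupType) (B L N : {set E}) :
    {set {ffun E -> E}} :=
  [set f : {ffun E -> E} |
    [&& [forall e in B, f e \in N],
        [forall e in B, forall e' in B, f (e * e') == f e * f e'],
        [forall e in B, forall l in L, f (e ^ l) == f e ^ l]
      & [forall e, (e \notin B) ==> (f e == 1)]]]%SET.

Lemma equivariant_homsP (E : finGroupType) (B L N : {set E})
    (f : {ffun E -> E}) :
  reflect [/\ forall e, e \in B -> f e \in N,
              {in B &, {morph f : e e' / e * e'}},
              forall e l, e \in B -> l \in L -> f (e ^ l) = f e ^ l
            & forall e, e \notin B -> f e = 1]
          (f \in equivariant_homs B L N).
Proof.
rewrite inE; apply: (iffP and4P) => -[fN fM fJ f1]; split.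
- by move=> e; move/forall_inP: fN; apply.
- move=> e e' eB e'B; apply/eqP.
  by move/forall_inP: fM => /(_ e eB)/forall_inP/(_ e' e'B).
- move=> e l eB lL; apply/eqP.
  by move/forall_inP: fJ => /(_ e eB)/forall_inP/(_ l lL).
- by move=> e eB; apply/eqP; move/forallP: f1 => /(_ e)/implyP/(_ eB).
- exact/forall_inP.
- by apply/forall_inP => e eB; apply/forall_inP => e' e'B; apply/eqP/fM.
- by apply/forall_inP => e eB; apply/forall_inP => l lL; apply/eqP/fJ.
- by apply/forallP => e; apply/implyP => eB; apply/eqP/f1.
Qed.

Lemma free_lift (gT : finGroupType) (n : nat) (F' F : profiniteGroupType)
    (x' : 'I_n -> F') (q : finhom F' gT) (p : finhom F gT) :
  free_profinite_on x' -> (forall b, exists a, p a = q b) ->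
  exists alpha : F' -> F, [/\ {morph alpha : a b / a * b}, continuous alpha
    & forall b, p (alpha b) = q b].
Proof.
move=> freeF' pq; have [y yP] := choice (fun j => pq (x' j)).
have [alpha [[aM aC ax] _]] := freeF' F y.
exists alpha; split=> //.
have pqC : closed [set b | p (alpha b) = q b].
  apply: locally_constant_eq_closed; last exact: finhom_lc.
  exact: (locally_constant_comp (@finhom_lc _ _ p) aC).
have pq1 : p (alpha 1) = q 1.
  by rewrite (morphg1 aM) !finhom1.
have pqM a b : p (alpha a) = q a -> p (alpha b) = q b ->
    p (alpha (a * b)) = q (a * b) by rewrite aM !finhomM => -> ->.
have pqV a : p (alpha a) = q a -> p (alpha a^-1) = q a^-1.
  by rewrite (morphgV aM) !finhomV => ->.
apply: (free_generated freeF' (C := ClosedSubgroup pqC pq1 pqM pqV)) => j /=.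
by rewrite ax.
Qed.

(** In this section F and F' map to the same subgroup of gT, with kernels R and
    R', and u normally generates R'.  The group N becomes a module on which F
    acts by conjugation through pi, and R trivially. *)
Section Counting.
Variables (gT : finGroupType) (n n' m : nat) (F F' : profiniteGroupType).
Variables (x : 'I_n -> F) (x' : 'I_n' -> F').
Hypotheses (freeF : free_profinite_on x) (freeF' : free_profinite_on x').
Variables (p : finhom F gT) (q : finhom F' gT).
Hypotheses (pq : forall b, exists a, p a = q b)
           (qp : forall a, exists b, q b = p a).
Variable u : 'I_m -> F'.
Hypothesis uR : forall K : set F', closed_normal_subgroup K ->
  (forall i, K (u i)) -> forall b, q b = 1 -> K b.
Hypothesis qu : forall i, q (u i) = 1.
Variables (E : finGroupType) (pi : finhom F E) (N : {group E}).
Hypothesis abN : abelian N.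
Hypothesis nN : forall a y, y \in N -> y ^ pi a \in N.
Hypothesis cN : forall r y, p r = 1 -> y \in N -> y ^ pi r = y.

Let L := himage pi setT.
Let B := himage pi [set a | p a = 1].

Let q1 : q 1 = 1. Proof. exact: finhom1. Qed.

Let cNN y z : y \in N -> z \in N -> y * z = z * y.
Proof. by move=> Ny Nz; apply: (centsP abN). Qed.

(** Choose alpha : F' -> F and beta : F -> F' over gT, and write N additively.
    An equivariant phi : R -> N and a derivation de : F' -> N give
    - ps = phi o alpha + de, an equivariant map R' -> N, known from the m
      values ps (u i);
    - Dv a = phi (a^-1 * alpha (beta a)) + de (beta a), a derivation F -> N,
      known from the n values Dv (x j).
    The pair (phi, de) can be recovered from (ps, Dv), because
    ps o beta = phi + Dv on R.  Finally, derivations F' -> N correspond to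
    arbitrary values at the n' free generators: they are the differences
    between pi o alpha and the homomorphisms theta that agree with it modulo
    N. *)
Lemma equivariant_homs_count :
  (#|equivariant_homs B L N| * #|N| ^ n' <= #|N| ^ (m + n))%N.
Proof.
have [alpha [aM aC pa]] := free_lift freeF' pq.
have [beta [bM bC qb]] := free_lift freeF qp.
pose ka b := pi (alpha b).
have kaM : {morph ka : b c / b * c} by move=> b c; rewrite /ka aM finhomM.
have lcka : locally_constant ka.
  exact: (locally_constant_comp (@finhom_lc _ _ pi) aC).
have cNka b y : q b = 1 -> y \in N -> y ^ ka b = y.
  by move=> qb1; apply: cN; rewrite pa.
have nNka b y : y \in N -> y ^ ka b \in N by exact: nN.
have [theta thetaP] := choice (fun h : {ffun 'I_n' -> E} =>
  free_finhom freeF' (fun j => ka (x' j) * h j)).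
(* The derivation F' -> N with value h j at the generator x' j. *)
pose de h b := (ka b)^-1 * theta h b.
have lcde h : locally_constant (de h).
  by move=> b; apply: filterS2 (lcka b) (@finhom_lc _ _ (theta h) b) => c;
    rewrite /de => -> ->.
have deM h b c : de h (b * c) = de h b ^ ka c * de h c.
  by rewrite /de kaM finhomM conjgE invMg !mulgA mulgK.
have de1 h : de h 1 = 1.
  by rewrite /de (morphg1 kaM) finhom1 invg1 mulg1.
have deV h b : de h b^-1 = (de h b ^ ka b^-1)^-1.
  by apply: (mulgI (de h b ^ ka b^-1)); rewrite -deM !mulgV de1.
have dex h j : de h (x' j) = h j by rewrite /de thetaP mulKg.
clearbody de.
pose HN := [set h : {ffun 'I_n' -> E} | [forall j, h j \in N]]%SET.
have deN h b : h \in HN -> de h b \in N.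
  rewrite inE => /forallP hN.
  have dC : closed [set b | (de h b \in N) = true].
    apply: locally_constant_eq_closed => [c|c].
      by apply: filterS (lcde h c) => c' /= ->.
    exact: nearW.
  have d1 : (de h 1 \in N) = true by rewrite de1 group1.
  have dM c c' : (de h c \in N) = true -> (de h c' \in N) = true ->
      (de h (c * c') \in N) = true.
    by move=> hc hc'; rewrite deM groupM // nNka.
  have dV c : (de h c \in N) = true -> (de h c^-1 \in N) = true.
    by move=> hc; rewrite deV groupV nNka.
  apply: (free_generated freeF' (C := ClosedSubgroup dC d1 dM dV)) => j /=.
  by rewrite dex hN.
pose ps (f : {ffun E -> E}) h b := f (ka b) * de h b.
pose ro a := a^-1 * alpha (beta a).
have pro a : p (ro a) = 1 by rewrite finhomM pa qb finhomV mulVg.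
have roM a b : ro (a * b) = ro a ^ b * ro b.
  by rewrite /ro bM aM conjgE invgM !mulgA mulgK.
have kab a : ka (beta a) = pi a * pi (ro a) by rewrite -finhomM mulVKg.
have lcro : locally_constant (fun a => pi (ro a)).
  move=> a; apply: filterS2 (@finhom_lc _ _ pi a)
    (locally_constant_comp lcka bC a) => b /=.
  by rewrite /ro !finhomM !finhomV /ka => -> ->.
clearbody ro.
pose Dv (f : {ffun E -> E}) h a := f (pi (ro a)) * de h (beta a).
pose EH := equivariant_homs B L N.
have inB r : p r = 1 -> pi r \in B by move=> pr; apply: mem_himage.
have inL a : pi a \in L by apply: mem_himage.
have kaB b : q b = 1 -> ka b \in B by move=> qb1; apply: inB; rewrite pa.
have psN f h b : f \in EH -> h \in HN -> q b = 1 -> ps f h b \in N.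
  by move=> /equivariant_homsP[fN _ _ _] hN qb1; rewrite groupM ?fN ?kaB ?deN.
have psM f h b c : f \in EH -> h \in HN -> q b = 1 -> q c = 1 ->
    ps f h (b * c) = ps f h b * ps f h c.
  move=> /equivariant_homsP[fN fM _ _] hN qb1 qc1.
  rewrite /ps kaM fM ?kaB // deM cNka ?deN // -!mulgA; congr (_ * _).
  by rewrite !mulgA; congr (_ * _); apply: cNN; rewrite ?fN ?kaB ?deN.
have psJ f h b c : f \in EH -> h \in HN -> q b = 1 ->
    ps f h (c^-1 * b * c) = ps f h b ^ ka c.
  move=> /equivariant_homsP[fN _ fJ _] hN qb1.
  rewrite /ps conjMg -(fJ _ _ (kaB _ qb1) (inL (alpha c))) -(morphgJ kaM).
  have -> : b ^ c = c^-1 * b * c by rewrite conjgE mulgA.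
  congr (_ * _).
  rewrite !deM (cNka b) ?deN // deV conjMg conjVg -conjgM.
  rewrite -kaM mulVg (morphg1 kaM).
  have Nbc : de h b ^ ka c \in N by rewrite nNka ?deN.
  by rewrite conjg1 -mulgA (cNN Nbc) ?deN // mulKg.
have DvN f h a : f \in EH -> h \in HN -> Dv f h a \in N.
  by move=> /equivariant_homsP[fN _ _ _] hN; rewrite groupM ?fN ?inB ?deN.
have DvM f h a b : f \in EH -> h \in HN ->
    Dv f h (a * b) = Dv f h a ^ pi b * Dv f h b.
  move=> /equivariant_homsP[fN fM fJ _] hN.
  rewrite /Dv roM bM finhomM fM ?inB // ?finhomJ ?fJ ?inB //.
    have Nde : de h (beta a) ^ pi b \in N by rewrite nN ?deN.
    rewrite deM kab conjgM (cN (pro b) Nde) conjMg.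
    move: (de h (beta a) ^ pi b) Nde (f (pi (ro a)) ^ pi b) => d Nd e.
    rewrite -!mulgA; congr (_ * _).
    by rewrite mulgA (cNN _ Nd) ?fN ?inB // -mulgA.
  by rewrite pro conj1g.
have injP f1 h1 f2 h2 : f1 \in EH -> h1 \in HN -> f2 \in EH -> h2 \in HN ->
    (forall i, ps f1 h1 (u i) = ps f2 h2 (u i)) ->
    (forall j, Dv f1 h1 (x j) = Dv f2 h2 (x j)) -> f1 = f2 /\ h1 = h2.
  move=> Ef1 Nh1 Ef2 Nh2 eps eDv.
  have {}eps b : q b = 1 -> ps f1 h1 b = ps f2 h2 b.
    pose K := [set b | q b = 1] `&` [set b | ps f1 h1 b = ps f2 h2 b].
    suff KN : closed_normal_subgroup K.
      by move=> qb1; have [] := uR KN (fun i => conj (qu i) (eps i)) qb1.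
    have lcps f h : locally_constant (ps f h).
      move=> c; apply: filterS2 (lcka c) (lcde h c) => d.
      by rewrite /ps => -> ->.
    split.
    - apply: closedI; apply: locally_constant_eq_closed => //.
        exact: finhom_lc.
      by move=> c; exact: nearW.
    - split=> //=; have ps1 f h : f \in EH -> h \in HN -> ps f h 1 = 1.
        move=> Ef Nh; apply: (mulgI (ps f h 1)).
        by rewrite -psM // !mulg1.
      by rewrite !ps1.
    - move=> b1 b2 [/= q1b e1] [/= q2b e2]; split=> /=.
        by rewrite finhomM q1b q2b mulg1.
      by rewrite !psM // e1 e2.
    - move=> b1 [/= q1b e1]; split=> /=; first by rewrite finhomV q1b invg1.
      have psV f h : f \in EH -> h \in HN -> ps f h b1^-1 = (ps f h b1)^-1.
        move=> Ef Nh; apply: (mulgI (ps f h b1)).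
        rewrite -psM // ?finhomV ?q1b ?invg1 // !mulgV.
        by apply: (mulgI (ps f h 1)); rewrite -psM // !mulg1.
      by rewrite !psV // e1.
    - move=> b1 b2 [/= q1b e1]; split=> /=.
        by rewrite !finhomM q1b mulg1 finhomV mulVg.
      by rewrite !psJ // e1.
  have {}eDv a : Dv f1 h1 a = Dv f2 h2 a.
    have lcDv f h : locally_constant (Dv f h).
      move=> c; apply: filterS2 (lcro c) (locally_constant_comp (lcde h) bC c).
      by move=> d /= e1 e2; rewrite /Dv e1 e2.
    have Dv1 f h : f \in EH -> h \in HN -> Dv f h 1 = 1.
      move=> Ef Nh; apply: (mulgI (Dv f h 1 ^ pi 1)).
      by rewrite -DvM // !mulg1 finhom1 conjg1.
    have DvV f h c : f \in EH -> h \in HN ->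
        Dv f h c^-1 = (Dv f h c ^ pi c^-1)^-1.
      move=> Ef Nh; apply: (mulgI (Dv f h c ^ pi c^-1)).
      by rewrite -DvM // !mulgV Dv1.
    have DC := locally_constant_eq_closed (lcDv f1 h1) (lcDv f2 h2).
    have D1 : Dv f1 h1 1 = Dv f2 h2 1 by rewrite !Dv1.
    have DM b c : Dv f1 h1 b = Dv f2 h2 b -> Dv f1 h1 c = Dv f2 h2 c ->
        Dv f1 h1 (b * c) = Dv f2 h2 (b * c) by rewrite !DvM // => -> ->.
    have DV b : Dv f1 h1 b = Dv f2 h2 b -> Dv f1 h1 b^-1 = Dv f2 h2 b^-1.
      by rewrite !DvV // => ->.
    exact: (free_generated freeF (C := ClosedSubgroup DC D1 DM DV)).
  have psb f h r : f \in EH -> h \in HN -> p r = 1 ->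
      ps f h (beta r) = f (pi r) * Dv f h r.
    move=> /equivariant_homsP[fN fM fJ _] Nh pr1.
    by rewrite /ps /Dv kab fM ?inB // mulgA.
  have f12 : f1 = f2.
    apply/ffunP => e; have [/himageP[r /= pr1 <-]|nBe] := boolP (e \in B).
      apply: (mulIg (Dv f1 h1 r)); rewrite -psb // eps ?qb // psb //.
      by rewrite eDv.
    have /equivariant_homsP[_ _ _ -> //] := Ef1.
    by have /equivariant_homsP[_ _ _ -> //] := Ef2.
  split=> //; rewrite -f12 in eps eDv.
  have deR b : q b = 1 -> de h1 b = de h2 b by move/eps/mulgI.
  have debeta a : de h1 (beta a) = de h2 (beta a).
    by have /mulgI := eDv a.
  apply/ffunP => j; rewrite -!dex.
  have qr : q ((beta (alpha (x' j)))^-1 * x' j) = 1.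
    by rewrite finhomM finhomV qb pa mulVg.
  (* Every element of F' is a product of one of the image of beta and one of R',
     and h1, h2 give the same derivation on both. *)
  rewrite -(mulVKg (beta (alpha (x' j))) (x' j)).
  by move: (_^-1 * _) qr => r qr; rewrite !deM debeta (deR r).
pose code (fh : {ffun E -> E} * {ffun 'I_n' -> E}) :
    {ffun ('I_m + 'I_n)%type -> E} :=
  [ffun k : ('I_m + 'I_n)%type => match k with
     | inl i => ps fh.1 fh.2 (u i)
     | inr j => Dv fh.1 fh.2 (x j)
     end].
have cardHN : #|HN| = (#|N| ^ n')%N.
  rewrite -[n' in RHS]card_ord -card_ffun_on; apply: eq_card => h.
  by rewrite inE; apply/forallP/ffun_onP.
have <- : #|(ffun_on N : pred {ffun ('I_m + 'I_n)%type -> E})| =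
    (#|N| ^ (m + n))%N.
  by rewrite card_ffun_on card_sum !card_ord.
rewrite -cardHN -cardsX -(card_in_imset (f := code)); last first.
  move=> [f1 h1] [f2 h2] /setXP[/= Ef1 Nh1] /setXP[/= Ef2 Nh2] e12.
  have [||-> -> //] := injP _ _ _ _ Ef1 Nh1 Ef2 Nh2.
    move=> i; have := congr1 (fun c : {ffun _} => c (inl i)) e12.
    by rewrite !ffunE.
  move=> i; have := congr1 (fun c : {ffun _} => c (inr i)) e12.
  by rewrite !ffunE.
apply/subset_leq_card/fintype.subsetP => _ /imsetP[[f h] /setXP[/= Ef Nh] ->].
by apply/ffun_onP => -[i|j]; rewrite ffunE /=; [exact: psN | exact: DvN].
Qed.

End Counting.

(** * Lifting normal generators *)

Section LiftNormalGenerators.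
Variables (E : finGroupType) (L B N : {group E}) (k : nat).
Hypotheses (nBL : B <| L) (minN : minnormal N L) (sNB : N \subset B).
Hypothesis k_gt0 : (0 < k)%N.
Hypothesis homs_le : abelian N -> B \subset 'C(N) ->
  (#|equivariant_homs B L N| <= #|N| ^ k)%N.
Variable vb : 'I_k -> coset_of N.
Hypothesis vbB : forall i, vb i \in B / N.
Hypothesis vb_gen :
  B / N \subset <<class_support [set vb i | i : 'I_k] (L / N)>>.

(** Fix lifts w of the generators vb; the other lifts are v a = w * a for a in
    N^k.  If the L-normal closure T a of v a is not B, then it is a complement
    of N in B, because it meets the minimal N trivially, and it determines a.
    If N is not abelian this is absurd, as T a is the centralizer of N in B for
    every a.  If N is abelian, then the projection of B to N along T a is an
    equivariant homomorphism; together with the trivial one this makes |N|^k + 1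
    homomorphisms. *)
Lemma lift_normal_generators : exists v : 'I_k -> E,
  (forall i, v i \in B) /\ B \subset <<class_support [set v i | i : 'I_k] L>>.
Proof.
have [ntN nNL] := andP (mingroupp minN).
have sBL := normal_sub nBL; have nBLn := normal_norm nBL.
have nNB : B \subset 'N(N) := fintype.subset_trans sBL nNL.
have /boolp.choice[w wP] : forall i, exists w, w \in B /\ coset N w = vb i.
  move=> i; have /morphimP[e _ eB ->] := vbB i; by exists e.
have wB i : w i \in B by have [] := wP i.
pose v (a : {ffun 'I_k -> E}) i := w i * a i.
pose T (a : {ffun 'I_k -> E}) := <<class_support [set v a i | i : 'I_k] L>>.
pose NN := [set a : {ffun 'I_k -> E} | [forall i, a i \in N]]%SET.
have aN a i : a \in NN -> a i \in N by rewrite inE => /forallP.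
have vB a i : a \in NN -> v a i \in B.
  by move=> aNN; rewrite groupM ?wB // (fintype.subsetP sNB) ?aN.
have vT a i : v a i \in T a.
  apply: mem_gen; apply/imset2P; exists (v a i) 1 => //; rewrite ?conjg1 //.
  exact: imset_f.
have nTL a : L \subset 'N(T a).
  by rewrite norms_gen // class_support_norm.
have sTB a : a \in NN -> T a \subset B.
  move=> aNN; rewrite gen_subG; apply/fintype.subsetP.
  move=> _ /imset2P[_ l /imsetP[i _ ->] lL ->].
  by rewrite memJ_norm ?vB // (fintype.subsetP nBLn).
apply: contrapT => noT.
have TN a : a \in NN -> B \subset N * T a.
  move=> aNN; have nNT := fintype.subset_trans (sTB a aNN) nNB.
  rewrite -quotientSK //; apply: (fintype.subset_trans vb_gen).
  rewrite gen_subG; apply/fintype.subsetP.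
  move=> _ /imset2P[_ l /imsetP[i _ ->] lL ->].
  rewrite memJ_norm; last first.
    by move: lL; apply/fintype.subsetP; exact: quotient_norms (nTL a).
  have [_ <-] := wP i.
  have -> : coset N (w i) = coset N (v a i).
    rewrite /v morphM ?(fintype.subsetP nNB) //; last first.
      by rewrite (fintype.subsetP sNB) ?aN.
    by rewrite /= (coset_id (aN a i aNN)) mulg1.
  by rewrite mem_morphim ?vT // (fintype.subsetP nNB) ?vB.
have TI a : a \in NN -> N :&: T a = 1.
  move=> aNN; apply/eqP; apply/negPn/negP => ntI.
  have sI : N :&: T a = N.
    have [_ minP] := mingroupP minN.
    apply: (minP (N :&: T a)%G); last exact: finset.subsetIl.
    by rewrite /= ntI /=; exact: normsI nNL (nTL a).
  apply: noT; exists (v a); split=> [i|]; first exact: vB.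
  apply: (fintype.subset_trans (TN a aNN)).
  by rewrite mul_subG //; apply/finset.setIidPl.
have cTN a : a \in NN -> T a \subset 'C(N).
  move=> aNN; apply/commG1P/trivgP; rewrite /= -(TI a aNN) finset.subsetI.
  rewrite commg_subr commg_subl; apply/andP; split.
    by apply: fintype.subset_trans nNB; exact: sTB.
  by apply: fintype.subset_trans (nTL a); apply: fintype.subset_trans sNB sBL.
have T_inj a b : a \in NN -> b \in NN -> T a = T b -> a = b.
  move=> aNN bNN Tab; apply/ffunP => i.
  have : (a i)^-1 * b i \in N :&: T a.
    rewrite inE groupM ?groupV ?aN //=.
    have -> : (a i)^-1 * b i = (v a i)^-1 * v b i.
      by rewrite /v invgM -mulgA mulKg.
    have vbT : v b i \in T a by rewrite Tab vT.
    by rewrite groupM ?groupV ?vT.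
  by rewrite TI // => /set1gP/eqP; rewrite -eq_mulVg1 => /eqP.
have [abN|nabN] := boolP (abelian N); last first.
  have ZN : 'Z(N) = 1.
    apply/eqP; apply/negPn/negP => ntZ; case/negP: nabN.
    have [_ minP] := mingroupP minN.
    have <- : 'Z(N) = N.
      apply: (minP ('Z(N))%G); last exact: center_sub.
      by rewrite ntZ /= gFnorm_trans.
    exact: center_abelian.
  have sTT a b : a \in NN -> b \in NN -> T b \subset T a.
    move=> aNN bNN; apply/fintype.subsetP => t tT.
    have /mulsgP[y t' yN t'T tE] : t \in N * T a.
      apply: (fintype.subsetP (TN a aNN)).
      exact: (fintype.subsetP (sTB b bNN)).
    have : y \in 'Z(N).
      rewrite inE yN /= -[y](mulgK t') -tE groupM ?groupV //.
        exact: (fintype.subsetP (cTN b bNN)).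
      exact: (fintype.subsetP (cTN a aNN)).
    by rewrite ZN => /set1gP y1; rewrite tE y1 mul1g.
  have /trivgPn[y yN ynt] := ntN.
  pose a0 : {ffun 'I_k -> E} := [ffun => 1].
  pose a1 : {ffun 'I_k -> E} := [ffun => y].
  have a0N : a0 \in NN by rewrite inE; apply/forallP => i; rewrite ffunE.
  have a1N : a1 \in NN by rewrite inE; apply/forallP => i; rewrite ffunE.
  have /ffunP/(_ (Ordinal k_gt0)) : a0 = a1.
    by apply: T_inj => //; apply/eqP; rewrite finset.eqEsubset !sTT.
  by rewrite !ffunE => y1; rewrite -y1 eqxx in ynt.
have sTNB a : a \in NN -> T a * N = B.
  move=> aNN; rewrite (normC (fintype.subset_trans (sTB a aNN) nNB)).
  apply/eqP; rewrite finset.eqEsubset TN // andbT mul_subG ?sTB //.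
have cBN : B \subset 'C(N).
  have a0N : [ffun => 1] \in NN.
    by rewrite inE; apply/forallP => i; rewrite ffunE.
  by rewrite -(sTNB _ a0N) mul_subG ?cTN.
have := homs_le abN cBN; rewrite leqNgt => /negP; apply.
have cardNN : #|NN| = (#|N| ^ k)%N.
  rewrite -[k in RHS]card_ord -card_ffun_on; apply: eq_card => h.
  by rewrite inE; apply/forallP/ffun_onP.
pose phi a : {ffun E -> E} :=
  [ffun e => if e \in B then remgr (T a) N e else 1].
have remT a t y : a \in NN -> t \in T a -> y \in N -> remgr (T a) N (t * y) = y.
  move=> aNN tT yN.
  by rewrite (remgrMid (K := [group of T a])) //= finset.setIC TI.
have phiE a t y : a \in NN -> t \in T a -> y \in N -> phi a (t * y) = y.
  move=> aNN tT yN; rewrite ffunE -(sTNB a aNN) mem_mulg // remT //.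
have phi_homs a : a \in NN -> phi a \in equivariant_homs B L N.
  move=> aNN.
  have inTN e : e \in B -> exists t y, [/\ t \in T a, y \in N & e = t * y].
    by rewrite -(sTNB a aNN) => /mulsgP[t y tT yN ->]; exists t, y.
  apply/equivariant_homsP; split=> [e|e e'|e l|e /negPf eB].
  - by case/inTN=> t [y [tT yN ->]]; rewrite phiE.
  - case/inTN=> t [y [tT yN ->]] /inTN[t' [y' [t'T y'N ->]]].
    have ct'y : commute y t' by apply/commute_sym/(centsP (cTN a aNN)).
    have -> : t * y * (t' * y') = (t * t') * (y * y').
      by rewrite mulgA -(mulgA t) ct'y !mulgA.
    rewrite (phiE a t y) // (phiE a t' y') //.
    by rewrite (phiE a (t * t') (y * y')) // groupM.
  - case/inTN=> t [y [tT yN ->]] lL; rewrite conjMg !phiE //.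
      by rewrite memJ_norm // (fintype.subsetP (nTL a)).
    by rewrite memJ_norm // (fintype.subsetP nNL).
  - by rewrite ffunE eB.
pose tr : {ffun E -> E} := [ffun => 1].
have tr_homs : tr \in equivariant_homs B L N.
  apply/equivariant_homsP; split=> [e|e e'|e l|e] *; rewrite !ffunE //.
    by rewrite mulg1.
  by rewrite conj1g.
have phi_inj : {in NN &, injective phi}.
  move=> a b aNN bNN ab; apply/ffunP => i; apply/esym.
  have e1 : phi b (v b i) = 1 by rewrite -[v b i]mulg1 phiE ?vT.
  have : phi a (v b i) = (a i)^-1 * b i.
    have -> : v b i = v a i * ((a i)^-1 * b i) by rewrite /v -mulgA mulKVg.
    by rewrite phiE ?vT // groupM ?groupV ?aN.
  by rewrite ab e1 => /esym/eqP; rewrite -eq_mulVg1 => /eqP.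
have sub : tr |: phi @: NN \subset equivariant_homs B L N.
  rewrite finset.subUset finset.sub1set tr_homs; apply/fintype.subsetP.
  by move=> _ /imsetP[a aNN ->]; exact: phi_homs.
apply: leq_trans (subset_leq_card sub).
rewrite cardsU1 card_in_imset // cardNN.
have [/imsetP[a aNN tra]|_] := boolP (tr \in phi @: NN); last by rewrite add1n.
have /trivgPn[y yN /negP[]] := ntN; apply/eqP.
by rewrite -(@phiE a 1 y) // -tra ffunE.
Qed.

End LiftNormalGenerators.

(** * Normal generators of a kernel *)

Section Criterion.
Variables (gT : finGroupType) (F : profiniteGroupType) (p : finhom F gT).
Variable k : nat.
Hypothesis k_gt0 : (0 < k)%N.
Hypothesis homs_le :
  forall (E : finGroupType) (pi : finhom F E) (N : {group E}),
  abelian N -> (forall a y, y \in N -> y ^ pi a \in N) ->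
  (forall r y, p r = 1 -> y \in N -> y ^ pi r = y) ->
  (#|equivariant_homs (himage pi [set a | p a = 1%g]) (himage pi setT) N|
    <= #|N| ^ k)%N.

Let ker : set F := [set a | p a = 1].

Let ker1 : ker 1. Proof. exact: finhom1. Qed.
Let kerM a b : ker a -> ker b -> ker (a * b).
Proof. by rewrite /ker /= finhomM => -> ->; rewrite mulg1. Qed.

(** Induction on the image of the kernel, dividing by a minimal normal subgroup
    N of the image of F.  The bound is assumed for all finite E because the
    quotient by N is a new target. *)
Lemma himage_ker_generated (E : finGroupType) (pi : finhom F E) :
  exists v : 'I_k -> E, (forall i, v i \in himage pi ker) /\
    himage pi ker \subset
      <<class_support [set v i | i : 'I_k] (himage pi setT)>>.
Proof.
have [b] := ubnP #|himage pi ker|; elim: b => // b IHb in E pi *.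
rewrite ltnS => leb.
pose B := Group (himage_group_set pi ker1 kerM).
pose L := Group (himage_group_set pi (S := setT) I (fun _ _ _ _ => I)).
have sBL : B \subset L.
  by apply/fintype.subsetP => _ /himageP[a _ <-]; apply: mem_himage.
have nBL : L \subset 'N(B).
  apply/fintype.subsetP => _ /himageP[a _ <-].
  rewrite inE; apply/fintype.subsetP.
  move=> _ /imsetP[_ /himageP[r /= pr <-] ->].
  rewrite -finhomJ; apply: mem_himage => /=.
  by rewrite /ker /= finhomJ pr conj1g.
have nsBL : B <| L by rewrite /normal sBL.
have [B1|ntB] := eqVneq (B : {set E}) 1.
  exists (fun=> 1); split=> [i|]; first exact: group1 B.
  by rewrite (_ : himage pi ker = 1) // sub1G.
have [N minN sNB] := minnormal_exists ntB nBL.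
have [ntN nNL] := andP (mingroupp minN).
have piN a : pi a \in 'N(N) by apply: (fintype.subsetP nNL); apply: mem_himage.
have pi2M : {morph (fun a => coset N (pi a)) : a b / a * b}.
  by move=> a c; rewrite finhomM morphM ?piN.
have lc2 : locally_constant (fun a => coset N (pi a)).
  by move=> a; apply: filterS (@finhom_lc _ _ pi a) => c /= ->.
pose pi2 := FinHom pi2M lc2.
have himage2 S : himage pi2 S = himage pi S / N.
  apply/setP => e; apply/himageP/morphimP => [[a Sa <-]|].
    by exists (pi a); rewrite ?piN // mem_himage.
  by case=> _ _ /himageP[a Sa <-] ->; exists a.
have [|vb [vbB vb_gen]] := IHb _ pi2.
  by rewrite himage2; apply: leq_trans (ltn_quotient ntN sNB) leb.
rewrite !himage2 in vb_gen.
have homsN : abelian N -> B \subset 'C(N) ->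
    (#|equivariant_homs B L N| <= #|N| ^ k)%N.
  move=> abN cBN; apply: homs_le => // [a y yN|r y pr yN].
    by rewrite memJ_norm.
  have /(fintype.subsetP cBN)/centP/(_ y yN) : pi r \in B by apply: mem_himage.
  by rewrite conjgE => /commute_sym; rewrite /commute => ->; rewrite mulKg.
apply: (lift_normal_generators (L := L) (B := B)
  nsBL minN sNB k_gt0 homsN _ vb_gen).
by move=> i; rewrite -himage2; exact: vbB.
Qed.

(** Generation of the image of the kernel as a normal subgroup of the image of
    F, phrased so that it passes to quotients of E at once. *)
Definition generates_in (E : finGroupType) (pi : finhom F E) (w : 'I_k -> F) :=
  forall K : {group E}, (forall a y, y \in K -> y ^ pi a \in K) ->
    (forall i, pi (w i) \in K) -> forall r, p r = 1 -> pi r \in K.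

Lemma generates_in_exists (E : finGroupType) (pi : finhom F E) :
  exists w : 'I_k -> F, (forall i, p (w i) = 1) /\ generates_in pi w.
Proof.
have [v [vB vgen]] := himage_ker_generated pi.
have /boolp.choice[w wP] : forall i, exists a, p a = 1 /\ pi a = v i.
  by move=> i; have /himageP[a /= pa pia] := vB i; exists a.
exists w; split=> [i|K nK wK r pr]; first by have [] := wP i.
suff sK : <<class_support [set v i | i : 'I_k] (himage pi setT)>> \subset K.
  by apply: (fintype.subsetP sK); apply: (fintype.subsetP vgen);
    apply: mem_himage.
rewrite gen_subG; apply/fintype.subsetP.
move=> _ /imset2P[_ _ /imsetP[i _ ->] /himageP[a _ <-] ->].
by apply: nK; have [_ <-] := wP i.
Qed.

Lemma pair_finhom (E1 E2 : finGroupType) (pi1 : finhom F E1)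
    (pi2 : finhom F E2) :
  exists pi : finhom F (E1 * E2)%type, forall a, pi a = (pi1 a, pi2 a).
Proof.
have piM : {morph (fun a => (pi1 a, pi2 a) : E1 * E2) : a b / a * b}.
  by move=> a b; rewrite !finhomM.
have lcpi : locally_constant (fun a => (pi1 a, pi2 a)).
  by move=> a; apply: filterS2 (@finhom_lc _ _ pi1 a)
    (@finhom_lc _ _ pi2 a) => b -> ->.
by exists (FinHom (E := (E1 * E2)%type) piM lcpi).
Qed.

(** The tuples that work for a given finite image form nonempty sets, filtering
    because two images are dominated by their product.  Each is closed since
    membership depends on finitely many locally constant data, so a cluster
    point in the compact F^k works for all finite images, and these determine
    closed subgroups. *)
Theorem kernel_normally_generated :
  exists w : 'I_k -> F, (forall i, p (w i) = 1) /\
    forall K : set F, closed_normal_subgroup K -> (forall i, K (w i)) ->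
      forall r, p r = 1 -> K r.
Proof.
pose X (E : finGroupType) (pi : finhom F E) : set ('I_k -> F) :=
  [set w | (forall i, p (w i) = 1) /\ generates_in pi w].
pose Phi : set_system ('I_k -> F) := [set S | exists E pi, @X E pi `<=` S].
have PPhi : ProperFilter Phi.
  split.
    by move=> [E [pi X0]]; have [w Xw] := generates_in_exists pi; exact: X0 Xw.
  split.
  - by exists gT, p.
  - move=> S1 S2 [E1 [pi1 XS1]] [E2 [pi2 XS2]].
    have [pi piE] := pair_finhom pi1 pi2.
    exists _, pi => w [pw gw].
    split; [apply: XS1 | apply: XS2]; split=> // K nK wK r pr.
      have : pi r \in setX_group K [set: E2]%G.
        apply: gw => // [a y|i]; rewrite piE !inE /= ?andbT; last exact: wK.
        exact: nK.
      by rewrite piE !inE andbT.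
    have : pi r \in setX_group [set: E1]%G K.
      apply: gw => // [a y|i]; rewrite piE !inE /=; [exact: nK|exact: wK].
    by rewrite piE !inE.
  - by move=> S1 S2 S12 [E [pi XS1]]; exists E, pi; apply: subset_trans S12.
have cptFk := tychonoff (T := fun _ : 'I_k => F)
  (fun i => @profinite_compact F).
have [w [_ clw]] := cptFk Phi PPhi
  (ex_intro _ gT (ex_intro _ p (fun _ _ _ => I))).
have Xw E (pi : finhom F E) : X E pi w.
  pose same i (w' : 'I_k -> F) := p (w' i) = p (w i) /\ pi (w' i) = pi (w i).
  have nw : nbhs w [set w' | forall i : 'I_k, same i w'].
    apply: (@filter_forall _ 'I_k same _ (nbhs_filter w)) => i.
    have prc := @proj_continuous _ (fun _ : 'I_k => F) i w.
    apply: (@filterS2 _ (nbhs w) (nbhs_filter w) _ _ _ _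
      (prc _ (@finhom_lc _ _ p (w i))) (prc _ (@finhom_lc _ _ pi (w i)))).
    by move=> w' /= e1 e2; split.
  have [w' [[pw' gw'] ww']] :=
    clw (X E pi) _ (ex_intro _ E (ex_intro _ pi (fun _ => id))) nw.
  split=> [i|K nK wK]; first by have [<- _] := ww' i; exact: pw'.
  by apply: gw' => // i; have [_ ->] := ww' i; exact: wK.
exists w; split=> [i|K [Kc K1 KM KV KJ] Kw r pr]; first by have [] := Xw _ p.
apply: contrapT => nKr.
have nW : nbhs (1 : F) [set c | ~ K (c * r)].
  apply: (@mulg_nearl _ (~` K)); rewrite mul1g.
  by apply: open_nbhs_nbhs; split=> //; exact: closed_openC.
have [E [pi piW]] := finhom_separates nW.
have [_ gw] := Xw _ pi.
have /himageP[s Ks pis] : pi r \in Group (himage_group_set pi K1 KM).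
  apply: gw => // [a _ /himageP[s Ks <-]|i]; last exact: mem_himage.
  rewrite -finhomJ; apply: mem_himage.
  by rewrite conjgE mulgA; exact: KJ.
apply: (piW (s * r^-1)); last by rewrite mulgVK.
by rewrite finhomM finhomV pis mulgV.
Qed.

End Criterion.

Definition kernel_generated (gT : finGroupType) (F : topologicalGroupType)
    (p : finhom F gT) (m : nat) :=
  exists u : 'I_m -> F, (forall i, p (u i) = 1) /\
    forall K : set F, closed_normal_subgroup K -> (forall i, K (u i)) ->
      forall r, p r = 1 -> K r.

Lemma free0_trivial (F : profiniteGroupType) (x : 'I_0 -> F) :
  free_profinite_on x -> forall a : F, a = 1.
Proof.
move=> freeF; have C1 : closed [set (1 : F)].
  exact/accessible_closed_set1/hausdorff_accessible/profinite_hausdorff.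
have CM (a b : F) : [set 1] a -> [set 1] b -> [set 1] (a * b).
  by move=> -> ->; rewrite /= mulg1.
have CV (a : F) : [set 1] a -> [set 1] a^-1 by move=> ->; rewrite /= invg1.
by apply: (free_generated freeF (C := ClosedSubgroup C1 erefl CM CV)) => -[].
Qed.

(** * Comparison of two presentations *)

Section Comparison.
Variables (gT : finGroupType) (n n' : nat) (F F' : profiniteGroupType).
Variables (x : 'I_n -> F) (x' : 'I_n' -> F').
Hypotheses (freeF : free_profinite_on x) (freeF' : free_profinite_on x').
Variables (p : finhom F gT) (q : finhom F' gT).
Hypotheses (pq : forall b, exists a, p a = q b)
           (qp : forall a, exists b, q b = p a).

(** Count the homomorphisms to a cyclic N of order |gT| + 1 with trivial action.
    The trivial one gives n' <= m + n.  If n > 0, map all generators of F to a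
    generator of N: the power |gT| of a generator of F is in the kernel of p but
    has nontrivial image in N, so there is a second homomorphism and the
    inequality is strict. *)
Lemma rank_le_relators m : kernel_generated q m ->
  (n' <= m + n)%N /\ ((0 < n)%N -> (n' < m + n)%N).
Proof.
move=> [u [qu uR]].
have count := equivariant_homs_count freeF freeF' pq qp uR qu.
pose E : finGroupType := 'I_(#|gT|.+1).
pose z : E := Zp1.
have abE : abelian [set: E]%SET by exact: Zp_abelian.
have [pi pix] := free_finhom freeF (fun=> z).
have cJ (e l : E) : e ^ l = e.
  by apply/conjg_fixP/commgP/(centsP abE); rewrite inE.
have {count} := count E pi [set: E]%G abE.
set H := equivariant_homs _ _ _ => count.
have {}count : (#|H| * #|gT|.+1 ^ n' <= #|gT|.+1 ^ (m + n))%N.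
  have -> : #|gT|.+1 = #|[set: E]%G| by rewrite cardsT card_ord.
  by apply: count => [a y|r y _ _]; rewrite ?inE ?cJ.
pose tr : {ffun E -> E} := [ffun => 1].
have trH : tr \in H.
  by apply/equivariant_homsP; split=> [e|e e'|e l|e] *;
    rewrite !ffunE ?inE ?mulg1 ?conj1g.
have gT_gt1 : (1 < #|gT|.+1)%N by rewrite ltnS; apply/card_gt0P; exists 1.
have H_gt0 : (0 < #|H|)%N by apply/card_gt0P; exists tr.
split=> [|n_gt0].
  by rewrite -(leq_exp2l _ _ gT_gt1); apply: leq_trans count; rewrite leq_pmull.
pose B := himage pi [set a | p a = 1].
have Bgrp : group_set B.
  apply: himage_group_set => [|a b /= pa pb].
    exact: finhom1.
  by rewrite finhomM pa pb mulg1.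
pose idB : {ffun E -> E} := [ffun e => if e \in B then e else 1].
have idBH : idB \in H.
  apply/equivariant_homsP; split=> [e _|e e'|e l|e].
  - by rewrite finset.in_setT.
  - by move=> eB e'B; rewrite !ffunE (groupM (G := Group Bgrp) eB e'B) eB e'B.
  - by move=> eB lL; rewrite !cJ.
  - by rewrite ffunE => /negPf ->.
pose r := x (Ordinal n_gt0) ^+ #|gT|.
have pr : p r = 1.
  by rewrite finhomX; apply/eqP; rewrite -order_dvdn -cardsT order_dvdG ?inE.
have pir : pi r != 1.
  rewrite finhomX pix -order_dvdn order_Zp1.
  by rewrite gtnNdvd //; apply/card_gt0P; exists 1.
have H_gt1 : (1 < #|H|)%N.
  have sH : [set tr; idB]%SET \subset H.
    by rewrite finset.subUset !finset.sub1set trH.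
  apply: leq_trans (subset_leq_card sH); rewrite cards2 ltnS lt0b.
  apply: contra pir => /eqP/ffunP/(_ (pi r)); rewrite !ffunE.
  by have -> : pi r \in B; [apply: mem_himage | move=> <-].
rewrite -(ltn_exp2l _ _ gT_gt1); apply: leq_trans count.
by rewrite ltn_Pmull // expn_gt0.
Qed.

(** For n = 0 the group F is trivial; for n > 0 the number m + n - n' is
    positive, so the criterion applies, with the bound given by the count. *)
Theorem kernel_generated_transfer m : kernel_generated q m ->
  (n' <= m + n)%N /\ kernel_generated p (m + n - n').
Proof.
move=> qm; have [le_n' lt_n'] := rank_le_relators qm; split=> //.
have [n0|n_gt0] := posnP n.
  exists (fun=> 1); split=> [_|K [_ K1 _ _ _] _ r _].
    exact: finhom1.
  suff -> : r = 1 by [].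
  by move: x freeF; rewrite n0 => x0 free0; exact: (free0_trivial free0).
apply: kernel_normally_generated; first by rewrite subn_gt0 lt_n'.
move=> E pi N abN nN cN; have [u [qu uR]] := qm.
have := equivariant_homs_count freeF freeF' pq qp uR qu abN nN cN.
rewrite -[X in (_ <= _ ^ X)%N](subnK le_n') expnD leq_pmul2r //.
by rewrite expn_gt0 cardG_gt0.
Qed.

End Comparison.

(** The multiplication table of the image: choose representatives s of the
    values of p, and take as normal generators the defects s(gh)^-1 s(g) s(h)
    and s(p x_j)^-1 x_j.  If K contains them, then the a with s(p a)^-1 a in K
    form a closed subgroup containing all x_j. *)
Theorem kernel_finitely_generated (gT : finGroupType) (n : nat)
    (F : profiniteGroupType) (x : 'I_n -> F) (p : finhom F gT) :
  free_profinite_on x -> exists m, kernel_generated p m.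
Proof.
move=> freeF.
have /boolp.choice[s sP] : forall g, exists b, (exists a, p a = g) -> p b = g.
  by move=> g; have [[a pa]|nex] := pselect (exists a, p a = g);
    [exists a | exists 1].
have {}sP a : p (s (p a)) = p a by apply: sP; exists a.
pose J : finType := ((gT * gT) + 'I_n)%type.
pose y (i : J) : F := match i with
  | inl (g, h) => (s (g * h))^-1 * s g * s h
  | inr j => (s (p (x j)))^-1 * x j end.
(* For g or h outside the image of p the defect need not lie in the kernel. *)
pose u i := if p (y i) == 1 then y i else 1.
exists #|J|, (fun k => u (enum_val k)); split=> [k|K [Kc K1 KM KV KJ] Ku r pr].
  by rewrite /u; case: eqP => // _; exact: finhom1.
have {Ku} Ky i : p (y i) = 1 -> K (y i).
  by move=> pyi; have := Ku (enum_rank i); rewrite enum_rankK /u pyi eqxx.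
have Kss a b : K ((s (p (a * b)))^-1 * s (p a) * s (p b)).
  rewrite finhomM; apply: (Ky (inl (p a, p b))) => /=.
  have pss : p (s (p a * p b)) = p a * p b by rewrite -finhomM sP.
  by rewrite !finhomM finhomV pss !sP -mulgA mulVg.
have Ks1 : K (s 1).
  have := Kss 1 1; rewrite mulg1 finhom1.
  by rewrite mulVg mul1g.
pose S := [set a | K ((s (p a))^-1 * a)].
have SC : closed S.
  rewrite -[S]setCK; apply: open_closedC; rewrite openE => a nSa.
  have oK : open (~` K) by exact: closed_openC.
  have nKa : nbhs ((s (p a))^-1 * a) (~` K) by apply: open_nbhs_nbhs.
  apply: filterS2 (@finhom_lc _ _ p a) (mulg_nearr nKa) => b /= pb.
  by rewrite /S /= pb.
have S1 : S 1 by rewrite /S /= finhom1 mulg1; exact: KV.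
have SM a b : S a -> S b -> S (a * b).
  rewrite /S /= => Sa Sb.
  have := KM _ _ (KM _ _ (Kss a b) (KJ _ (s (p b)) Sa)) Sb.
  by rewrite !mulgA !mulgK.
have SV a : S a -> S a^-1.
  rewrite /S /= => Sa; have := Kss a a^-1; rewrite mulgV finhom1.
  move=> /(KM _ _ Ks1); rewrite !mulgA mulgV mul1g => /KV.
  rewrite invgM => Kss'.
  have := KM _ _ Kss' (KJ _ (s (p a))^-1 (KV _ Sa)).
  by rewrite !invgM !invgK !mulgA !mulgK !mulgVK.
have Sr : S r.
  apply: (free_generated freeF (C := ClosedSubgroup SC S1 SM SV)) => j.
  apply: (Ky (inr j)) => /=.
  by rewrite finhomM finhomV sP mulVg.
have := KM _ _ Ks1 Sr.
by rewrite pr mulVKg.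
Qed.

(** * Presentations of a finite group *)

HB.instance Definition _ (F : topologicalGroupType) (E : finGroupType)
  (pi : finhom F E) := isMultiplicative.Build F E pi (@finhomM _ _ pi).

Lemma kernel_closed_normal (F : topologicalGroupType) (E : finGroupType)
    (pi : finhom F E) : closed_normal_subgroup [set a | pi a = 1].
Proof.
split=> /=.
- apply: locally_constant_eq_closed; first exact: finhom_lc.
  by move=> a; exact: nearW.
- exact: finhom1.
- by move=> a b pa pb; rewrite finhomM pa pb mulg1.
- by move=> a pa; rewrite finhomV pa invg1.
- by move=> a b pa; rewrite !finhomM pa mulg1 finhomV mulVg.
Qed.

Lemma closed_normal_closure_closed_normal (F : topologicalGroupType)
    (U : set F) :
  closed_normal_subgroup (closed_normal_closure U).
Proof.
split.
- by apply: closed_bigI => K [[]].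
- by move=> K [[]].
- by move=> a b Ua Ub K [KN UK]; have [_ _ KM _ _] := KN;
    apply: KM; [exact: Ua | exact: Ub].
- by move=> a Ua K [KN UK]; have [_ _ _ KV _] := KN; apply: KV; exact: Ua.
- by move=> a b Ua K [KN UK]; have [_ _ _ _ KJ] := KN; apply: KJ; exact: Ua.
Qed.

Definition maps_onto (F : topologicalGroupType) (gT : finGroupType)
    (p : finhom F gT) (G : {set gT}) := forall g, g \in G <-> exists a, p a = g.

(** A homomorphism to a finite group with closed kernel is continuous: its
    finitely many fibres are closed, being cosets of the kernel or empty. *)
Lemma quotient_iso_finhom (F : topologicalGroupType) (R : set F)
    (gT : finGroupType) (G : {group gT}) :
  closed_normal_subgroup R -> quotient_iso_to R G ->
  exists p : finhom F gT, maps_onto p G /\ R = [set a | p a = 1].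
Proof.
move=> [Rc _ _ _ _] [p [imp kerp]].
have pM : {morph p : a b / a * b} by exact: gmulfM.
have lcp : locally_constant p.
  move=> a.
  have : \forall b \near a, forall g : gT, g != p a -> p b <> g.
    apply: filter_forall => g.
    have [->|gpa] := eqVneq g (p a); first exact: nearW.
    have [[d pd]|nex] := pselect (exists d, p d = g); last first.
      by apply: nearW => b _ pbg; apply: nex; exists b.
    have nR : nbhs (d^-1 * a) (~` R).
      apply: open_nbhs_nbhs; split; first exact: closed_openC.
      rewrite -kerp /= pM (morphgV pM) pd => /eqP.
      by rewrite -eq_mulVg1 (negPf gpa).
    apply: filterS (mulg_nearr nR) => b nRb _ pbg; apply: nRb.
    by rewrite -kerp /= pM (morphgV pM) pd pbg mulVg.
  apply: filterS => b pb; apply/eqP; apply: contraT => npb.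
  by have := pb (p b); rewrite npb => /(_ isT).
exists (FinHom pM lcp); split=> [g /=|]; last by rewrite -kerp.
split=> [gG|[a <-]].
  by have [a _ <-] : range p g; [rewrite imp | exists a].
have : range p (p a) by exists a.
by rewrite imp.
Qed.

Lemma finhom_quotient_iso (F : topologicalGroupType) (gT : finGroupType)
    (G : {group gT}) (p : finhom F gT) :
  maps_onto p G -> quotient_iso_to [set a | p a = 1] G.
Proof.
move=> pG; exists (p : {multiplicative F -> gT}); split=> //.
rewrite predeqE => g; split=> [[a _ <-]|/= /pG[a <-]]; last by exists a.
by apply/pG; exists a.
Qed.

Lemma normally_generated_kernel (F : topologicalGroupType) (gT : finGroupType)
    (p : finhom F gT) m :
  normally_generated_by [set a | p a = 1] m -> kernel_generated p m.
Proof.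
move=> [U [Um clU]]; have /card_bijP[f [g fK gK]] := Um.
pose u (i : 'I_m) : F := set_val (g (exist _ (i : nat) (mem_set (ltn_ord i)))).
have uU i : U (u i) by exact: set_valP.
exists u; split=> [i|K KN Ku r].
  suff : [set a | p a = 1] (u i) by [].
  by rewrite -clU => K [_ UK]; exact: UK.
change ([set a | p a = 1] r -> K r); rewrite -clU; apply; split=> // a Ua.
pose i := f (exist _ a (mem_set Ua)).
have im : (set_val i < m)%N by exact: (set_valP i).
have <- : u (Ordinal im) = a; last exact: Ku.
by rewrite /u (_ : exist _ _ _ = i) ?fK //; apply: val_inj.
Qed.

(** The family may have repetitions, so its set of values can have fewer than m
    elements. *)
Lemma kernel_generated_normally (F : topologicalGroupType) (gT : finGroupType)
    (p : finhom F gT) m : kernel_generated p m ->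
  exists2 m', (m' <= m)%N & normally_generated_by [set a | p a = 1] m'.
Proof.
move=> [u [pu uR]].
have leU : (range u #<= `I_m)%card.
  apply: card_le_trans (card_image_le u setT) _.
  by rewrite (card_le_eql (card_esym card_II)).
have /finite_setP[m' Um'] : finite_set (range u) by exact: finite_image.
exists m'; first by rewrite -card_le_II -(card_le_eql Um').
exists (range u); split=> //; rewrite eqEsubset; split.
  apply: smallest_sub; first exact: kernel_closed_normal.
  by move=> _ [i _ <-]; exact: pu.
move=> r /= pr; apply: uR => // [|i].
  exact: closed_normal_closure_closed_normal.
by move=> K [_ UK]; apply: UK; exists i.
Qed.

Lemma least_exists (P : nat -> Prop) : (exists m, P m) -> exists m, least P m.
Proof.
move=> [m Pm]; have exP : exists k, `[< P k >] by exists m; exact/asboolP.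
case: (ex_minnP exP) => k /asboolP Pk kmin; exists k; split=> // j Pj.
by apply: kmin; exact/asboolP.
Qed.

Lemma maps_onto_generated (n : nat) (F : profiniteGroupType) (x : 'I_n -> F)
    (gT : finGroupType) (p : finhom F gT) :
  free_profinite_on x -> maps_onto p <<[set p (x i) | i : 'I_n]>>.
Proof.
move=> freeF; pose H := <<[set p (x i) | i : 'I_n]>>%G => g.
have pimg : group_set (himage p setT) by exact: himage_group_set.
split=> [gH|[a <-]].
  have /himageP[a _ <-] : g \in Group pimg; last by exists a.
  apply: (fintype.subsetP _ _ gH); rewrite gen_subG.
  by apply/fintype.subsetP => _ /imsetP[i _ ->]; exact: mem_himage.
have C : closed [set a | (p a \in H) = true].
  apply: locally_constant_eq_closed => [b|b]; last exact: nearW.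
  by apply: filterS (@finhom_lc _ _ p b) => c /= ->.
have C1 : (p 1 \in H) = true by rewrite finhom1 group1.
have CM b c : (p b \in H) = true -> (p c \in H) = true ->
    (p (b * c) \in H) = true.
  by move=> Hb Hc; rewrite finhomM groupM.
have CV b : (p b \in H) = true -> (p b^-1 \in H) = true.
  by move=> Hb; rewrite finhomV groupV.
apply: (free_generated freeF (C := ClosedSubgroup C C1 CM CV)) => i /=.
by apply: mem_gen; exact: imset_f.
Qed.

Lemma grank_le_rank (n : nat) (F : profiniteGroupType) (x : 'I_n -> F)
    (gT : finGroupType) (G : {group gT}) (p : finhom F gT) :
  free_profinite_on x -> maps_onto p G -> ('m(G) <= n)%N.
Proof.
move=> freeF pG; have pH := maps_onto_generated p freeF.
have -> : G = <<[set p (x i) | i : 'I_n]>> :> {set gT}.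
  apply/setP => g; apply/idP/idP => [/pG/pH //|/pH/pG //].
apply: leq_trans (grank_min _) _.
by apply: leq_trans (leq_imset_card _ _) _; rewrite card_ord.
Qed.

Lemma minimal_presentation (gT : finGroupType) (G : {group gT})
    (F : profiniteGroupType) (x : 'I_('m(G)) -> F) :
  free_profinite_on x -> exists p : finhom F gT, maps_onto p G.
Proof.
move=> freeF; have [B genB cardB] := grank_witness G.
have [p px] := free_finhom freeF (fun i => enum_val (cast_ord (esym cardB) i)).
exists p => g; rewrite -genB.
rewrite (_ : B = [set p (x i) | i : 'I_('m(G))]%SET); last first.
  apply/setP => b; apply/idP/imsetP => [bB|[i _ ->]]; last first.
    by rewrite px enum_valP.
  exists (cast_ord cardB (enum_rank_in bB b)) => //.
  by rewrite px cast_ordK enum_rankK_in.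
exact: maps_onto_generated.
Qed.

Theorem lemma3p15 (gT : finGroupType) (G : {group gT}) (c : nat)
    (F : profiniteGroupType) (x : 'I_('m(G) + c) -> F) (R : set F)
    (freeF : free_profinite_on x) (closedR : closed_normal_subgroup R)
    (presG : quotient_iso_to R G) :
  exists e r : nat,
    [/\ least (normally_generated_by R) e,
        is_rhat G r,
        e = (r + c)%N
      & forall n : nat, profinite_presentation G n r <-> n = 'm(G)].
Proof.
have [p [pG ->]] := quotient_iso_finhom closedR presG.
have same_image (F1 F2 : profiniteGroupType) (p1 : finhom F1 gT)
    (p2 : finhom F2 gT) :
    maps_onto p1 G -> maps_onto p2 G -> forall b, exists a, p1 a = p2 b.
  by move=> p1G p2G b; apply/p1G/p2G; exists b.
have [e [genRe mine]] :
    exists e, least (normally_generated_by [set a | p a = 1]) e.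
  apply: least_exists; have [m pm] := kernel_finitely_generated p freeF.
  by have [m' _ ?] := kernel_generated_normally pm; exists m'.
have min_kg k : kernel_generated p k -> (e <= k)%N.
  by move=> /kernel_generated_normally[k' k'k /mine/leq_trans]; apply.
have bound n m : profinite_presentation G n m ->
    [/\ 'm(G) <= n, n <= m + ('m(G) + c) & e <= m + ('m(G) + c) - n]%N.
  move=> [F1 [x1 [U [free1 Um pres1]]]].
  have [p1 [p1G kerp1]] :=
    quotient_iso_finhom (closed_normal_closure_closed_normal U) pres1.
  have kg1 : kernel_generated p1 m.
    by apply: normally_generated_kernel; rewrite -kerp1; exists U.
  have [le_n kgp] := kernel_generated_transfer freeF free1
    (same_image _ _ _ _ pG p1G) (same_image _ _ _ _ p1G pG) kg1.
  by split=> //; [exact: grank_le_rank free1 p1G | exact: min_kg].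
have [F0 [x0 free0]] := free_retract freeF.
have [p0 p0G] := minimal_presentation free0.
have [le_c kg0] := kernel_generated_transfer free0 freeF
  (same_image _ _ _ _ p0G pG) (same_image _ _ _ _ pG p0G)
  (normally_generated_kernel genRe).
have {le_c} le_c : (c <= e)%N by rewrite addnC leq_add2r in le_c.
rewrite addnC subnDl in kg0.
have [r ler [U [Ur clU]]] := kernel_generated_normally kg0.
have pres0 : profinite_presentation G 'm(G) r.
  by exists F0, x0, U; split=> //; rewrite clU; exact: finhom_quotient_iso.
have rE : r = (e - c)%N.
  apply/eqP; rewrite eqn_leq ler leq_subLR addnC.
  by have [_ _] := bound _ _ pres0; rewrite addnCA addKn.
exists e, r; split.
- by [].
- split=> [|m [n /bound[le_n _ le_e]]]; first by exists 'm(G).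
  rewrite rE leq_subLR addnC; apply: leq_trans le_e _.
  by rewrite leq_subLR addnCA leq_add2r.
- by rewrite rE subnK.
- move=> n; split=> [/bound[le_n n_le le_e]|->//].
  move: le_e; rewrite leq_subRL // rE addnCA subnK // leq_add2r => n_le'.
  by apply/eqP; rewrite eqn_leq n_le' le_n.
Qed.
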